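(* For every integer $\lambda\geq 3$, Breaker has a winning strategy in the bichromatic Maker-Breaker game with bias $1:2\lambda$ whenever $k\geq 3\lceil 2\lambda/(\lambda-2)\rceil-1$. In particular, Breaker wins if $k\geq 17$ for $\lambda=3$; if $k\geq 11$ for $\lambda\in\{4,5\}$; and if $k\geq 8$ for $\lambda\geq 6$.
   Context: Bichromatic Maker-Breaker game with bias $1:s$: Maker and Breaker alternately place points in the plane, Maker starting; in each round Maker places one point and then Breaker places $s$ points. Let $M$ and $B$ be the sets of points placed by Maker and Breaker; $S=M\cup B$ must always be in general position (no three collinear). Maker wins if at some time there is a $k$-hole $H$ of $S$ with $H\subseteq M$; Breaker wins if she can prolong the game indefinitely without this happening. A $k$-hole of $S$ is a subset $H\subseteq S$ of size $k$ such that $\mathrm{conv}(H)$ is a convex $k$-gon and $\mathrm{conv}(H)\cap S=H$. *)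

(* Defs.v *)
From mathcomp Require Import all_boot all_order all_algebra archimedean.
From mathcomp Require Import mathcomp_extra boolp classical_sets functions.
From mathcomp Require Import cardinality reals convex.

Set Implicit Arguments.
Unset Strict Implicit.
Unset Printing Implicit Defensive.
Import Order.TTheory GRing.Theory Num.Theory.
Local Open Scope classical_set_scope.
Local Open Scope ring_scope.

Notation plane R := 'rV[R]_2.

Section Geometry.
Context {R : realType}.
Implicit Types (S H P V L A : set (plane R)) (x y z : plane R).

Definition is_line L :=
  exists p v : plane R, v != 0 /\ L = [set p + t *: v | t in [set: R]].

Definition collinear x y z := exists2 L, is_line L & [set x; y; z] `<=` L.

Definition general_position S :=
  forall x y z, S x -> S y -> S z -> x <> y -> y <> z -> x <> z ->
    ~ collinear x y z.

Definition convex_hull A : set (plane R) :=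
  smallest (@convex_set R (plane R)) A.

(* Meaningful for k >= 3: V is the set of vertices of P, and the third
   condition says that the vertices are in strictly convex position. *)
Definition convex_gon (k : nat) P :=
  exists V, [/\ (V #= `I_k)%card, P = convex_hull V &
    forall x, V x -> ~ convex_hull (V `\ x) x].

Definition hole (k : nat) S H :=
  [/\ H `<=` S, (H #= `I_k)%card, convex_gon k (convex_hull H) &
      convex_hull H `&` S = H].

End Geometry.

(* A position is the sequence of all points placed so far, in order of
   placement; the position determines who placed which point: with bias 1:s,
   point number i (from 0) is Maker's iff s.+1 divides i. The s points of a
   Breaker move are thus recorded one after the other; as Maker does not act in
   between, this is the same as placing them all at once. *)
Section Game.
Context {R : realType}.
Variable s : nat.
Implicit Types h : seq (plane R).

Definition maker_turn (i : nat) : bool := (s.+1 %| i)%N.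

Definition placed h : set (plane R) := [set` h].

Definition maker_points h : set (plane R) :=
  [set nth 0 h i | i in [set i | (i < size h)%N && maker_turn i]].

(* [uniq]: a player may not place a point on an already placed one. *)
Definition legal h := uniq h /\ general_position (placed h).

Definition maker_won (k : nat) h :=
  exists2 H, H `<=` maker_points h & hole k (placed h) H.

Definition breaker_strategy := seq (plane R) -> plane R.

Definition follows (sigma : breaker_strategy) h :=
  forall i, (i < size h)%N -> ~~ maker_turn i -> nth 0 h i = sigma (take i h).

(* At every position reachable against sigma, whatever Maker plays, Maker has
   not won and, when it is Breaker's turn, sigma provides a legal point.
   General position is inherited by subsets, so [legal h] says that the rules
   were respected throughout the play leading to h. *)
Definition winning (k : nat) (sigma : breaker_strategy) :=
  forall h, legal h -> follows sigma h ->
    ~ maker_won k h /\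
    (~~ maker_turn (size h) -> legal (rcons h (sigma h))).

End Game.

Definition breaker_wins (R : realType) (s k : nat) :=
  exists sigma : @breaker_strategy R, winning s k sigma.

(* Main.v *)
Require Import Defs.
From mathcomp Require Import all_boot all_order all_algebra archimedean.
From mathcomp Require Import reals.
From mathcomp Require Import boolp classical_sets functions cardinality.
From mathcomp Require Import interval_inference convex ring lra zify.

Set Implicit Arguments.
Unset Strict Implicit.
Unset Printing Implicit Defensive.
Import Order.TTheory GRing.Theory Num.Theory.
Local Open Scope classical_set_scope.
Local Open Scope ring_scope.

(* Breaker surrounds every Maker point [v] by a shield: three points, seen from
   [v] in nearly fixed directions spanning the plane positively, so close to [v]
   that every wedge at [v] between two older Maker points, or between an older
   one and a point outside a disc around [v], catches them unless it is almost
   a half-plane. The discs are disjoint, so a new Maker point enters at most one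
   of them; three points shield the new point, and three renew the shield of the
   centre of the disc it entered.

   After a full round an empty convex polygon [H] of Maker points has at most
   five vertices. If at a vertex [v] the polygon avoids the directions of the
   shield, then [H] lies in one of the three sectors at [v], and each of the
   three sectors serves for at most one vertex. Otherwise some shield point is
   seen inside the angle of [H] at [v]; if two vertices of [H] are older than
   [v], one of the triangles they form with [v] and the other vertices is not
   almost flat and contains that shield point. So all but the two oldest
   vertices are of the first kind. Maker's next move adds one vertex, so she
   never gets a 7-hole, even when Breaker places only six points per round;
   and the hypotheses of the theorem imply [k >= 8]. *)

(** * Determinants, the 1-norm and cones in the plane *)

Section PlaneAlgebra.
Context {R : realType}.
Implicit Types (a b u v w x y : plane R) (s t : R).

Lemma plane_eq u v : u 0 0 = v 0 0 -> u 0 1 = v 0 1 -> u = v.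
Proof.
move=> h0 h1; apply/rowP => i.
by case: (unliftP ord0 i) => [j|] -> //; rewrite [j]ord1 (_ : lift _ _ = 1) //; apply/val_inj.
Qed.

Definition cross u v : R := u 0 0 * v 0 1 - u 0 1 * v 0 0.

Definition norm1 u : R := `|u 0 0| + `|u 0 1|.

Definition in_cone a b x :=
  exists s t, [/\ 0 <= s, 0 <= t & x = s *: a + t *: b].

Definition in_triangle a b x :=
  exists s t, [/\ 0 <= s, 0 <= t, s + t <= 1 & x = s *: a + t *: b].

Lemma norm1_ge0 u : 0 <= norm1 u.
Proof. by rewrite addr_ge0. Qed.

Lemma norm1_gt0 u : u != 0 -> 0 < norm1 u.
Proof.
rewrite lt_def norm1_ge0 andbT; apply: contraNneq => /eqP.
rewrite paddr_eq0 // !normr_eq0 => /andP[/eqP h0 /eqP h1].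
by apply/eqP/plane_eq; rewrite ?h0 ?h1 mxE.
Qed.

Lemma norm1D u v : norm1 (u + v) <= norm1 u + norm1 v.
Proof.
rewrite /norm1 !mxE.
by have := ler_normD (u 0 0) (v 0 0); have := ler_normD (u 0 1) (v 0 1); lra.
Qed.

Lemma norm1N u : norm1 (- u) = norm1 u.
Proof. by rewrite /norm1 !mxE !normrN. Qed.

Lemma norm1B u v : norm1 (u - v) = norm1 (v - u).
Proof. by rewrite -norm1N opprB. Qed.

Lemma norm1Z t u : norm1 (t *: u) = `|t| * norm1 u.
Proof. by rewrite /norm1 !mxE !normrM mulrDr. Qed.

Lemma norm1_lt u t : norm1 u < t ->
  [/\ - t < u 0 0, u 0 0 < t, - t < u 0 1 & u 0 1 < t].
Proof.
rewrite /norm1 => h.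
have /ltr_normlP[] : `|u 0 0| < t by have := normr_ge0 (u 0 1); lra.
have /ltr_normlP[] : `|u 0 1| < t by have := normr_ge0 (u 0 0); lra.
by split; lra.
Qed.

Lemma cross_antisym u v : cross u v = - cross v u.
Proof. by rewrite /cross; ring. Qed.

Lemma cross_le u v : `|cross u v| <= norm1 u * norm1 v.
Proof.
rewrite /cross /norm1; apply: le_trans (ler_normB _ _) _; rewrite !normrM.
have := normr_ge0 (u 0 0); have := normr_ge0 (u 0 1).
have := normr_ge0 (v 0 0); have := normr_ge0 (v 0 1); nra.
Qed.

Lemma cross_decompose a b x : cross a b != 0 ->
  x = (cross x b / cross a b) *: a + (cross a x / cross a b) *: b.
Proof.
move=> h; have h' : a 0 0 * b 0 1 - a 0 1 * b 0 0 != 0 := h.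
by apply: plane_eq; rewrite !mxE /cross; field.
Qed.

Lemma cross0_parallel u v : u != 0 -> cross u v = 0 -> exists t, v = t *: u.
Proof.
move=> u0; rewrite /cross => uv.
have [h|h] := eqVneq (u 0 0) 0.
  have h1 : u 0 1 != 0.
    by apply: contraNneq u0 => h1; apply/eqP/plane_eq; rewrite mxE.
  exists (v 0 1 / u 0 1); apply: plane_eq; rewrite !mxE; last by field.
  apply: (mulfI h1); rewrite h; move: uv; rewrite h; lra.
exists (v 0 0 / u 0 0); apply: plane_eq; rewrite !mxE; first by field.
apply: (mulfI h); transitivity (u 0 1 * v 0 0); [by lra | by field].
Qed.

Lemma in_coneC a b x : in_cone a b x -> in_cone b a x.
Proof. by case=> s [t [s0 t0 ->]]; exists t, s; rewrite addrC. Qed.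

(* A point of a cone lies in one of the two cones obtained by trading a
   generator for [e], unless [e] points away from the cone. *)
Lemma in_cone_exchange a b e x : cross a b != 0 -> in_cone a b x ->
  [\/ in_cone a e x, in_cone e b x |
      exists s t, [/\ 0 <= s, 0 <= t & e + s *: a + t *: b = 0]].
Proof.
move=> ab [s [t [s0 t0 xE]]].
have := cross_decompose e ab; set p := _ / _; set q := _ / _ => eE.
have [p0|p0] := ltP 0 p; have [q0|q0] := ltP 0 q.
- have [st|st] := leP (s * q) (t * p).
  + apply: Or32; exists (s / p), (t - s * q / p); split.
    * by rewrite divr_ge0 // ltW.
    * by rewrite subr_ge0 ler_pdivrMr.
    * by rewrite xE {1}eE; apply: plane_eq; rewrite !mxE; field; rewrite gt_eqF.
  + apply: Or31; exists (s - t * p / q), (t / q); split.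
    * by rewrite subr_ge0 ler_pdivrMr // ltW.
    * by rewrite divr_ge0 // ltW.
    * by rewrite xE {1}eE; apply: plane_eq; rewrite !mxE; field; rewrite gt_eqF.
- apply: Or32; exists (s / p), (t - s * q / p); split.
  + by rewrite divr_ge0 // ltW.
  + by rewrite subr_ge0 ler_pdivrMr //; nra.
  + by rewrite xE {1}eE; apply: plane_eq; rewrite !mxE; field; rewrite gt_eqF.
- apply: Or31; exists (s - t * p / q), (t / q); split.
  + by rewrite subr_ge0 ler_pdivrMr //; nra.
  + by rewrite divr_ge0 // ltW.
  + by rewrite xE {1}eE; apply: plane_eq; rewrite !mxE; field; rewrite gt_eqF.
- apply: Or33; exists (- p), (- q); split; rewrite ?oppr_ge0 //.
  by rewrite {1}eE; apply: plane_eq; rewrite !mxE; ring.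
Qed.

(** Cramer's rule: [s * cross a b] and [t * cross a b] are determinants of the combination with [b]
    and with [a], which [cross_le] bounds. *)
Lemma independent_bound a b : cross a b != 0 -> exists2 K, 0 < K &
  forall s t, `|s| + `|t| <= K * norm1 (s *: a + t *: b).
Proof.
move=> ab; have D0 : 0 < `|cross a b| by rewrite normr_gt0.
exists ((1 + norm1 a + norm1 b) / `|cross a b|).
  by rewrite divr_gt0 //; have := norm1_ge0 a; have := norm1_ge0 b; lra.
move=> s t; set x := s *: a + t *: b.
have hs : `|s| * `|cross a b| <= norm1 x * norm1 b.
  have <- : `|cross x b| = `|s| * `|cross a b|.
    by rewrite -normrM; congr `|_|; rewrite /x /cross !mxE; ring.
  exact: cross_le.
have ht : `|t| * `|cross a b| <= norm1 a * norm1 x.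
  have <- : `|cross a x| = `|t| * `|cross a b|.
    by rewrite -normrM; congr `|_|; rewrite /x /cross !mxE; ring.
  exact: cross_le.
rewrite mulrAC ler_pdivlMr // mulrDl.
by have := norm1_ge0 x; nra.
Qed.

(* Near [0] every point [x] of a cone over two points lies in the triangle they
   span with [0], unless the cone is almost a half-plane. If [w] is kept away
   from [0], the cones over [a, w] and over [b, w] cannot both be almost
   half-planes: then [a] and [b] would have almost the same direction. *)
Lemma guard_exists a b r : cross a b != 0 -> 0 < r -> exists2 d, 0 < d &
  forall x, norm1 x < d ->
    (in_cone a b x -> in_triangle a b x) /\
    (forall w, r <= norm1 w -> in_cone a w x -> in_cone b w x ->
       in_triangle a w x \/ in_triangle b w x).
Proof.
move=> ab r0; have [K K0 hK] := independent_bound ab.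
set L := 1 + norm1 a + norm1 b.
have L1 : 1 <= L by have := norm1_ge0 a; have := norm1_ge0 b; rewrite /L; lra.
have L0 : 0 < L by lra.
(* [c] is a lower bound for the coefficients of [a] and [b] in flat cones. *)
have [c [c0 c1 cr]] : exists c, [/\ 0 < c, c <= 2^-1 & c * (4 * L) <= r].
  exists (Num.min 2^-1 (r / (4 * L))).
  rewrite lt_min ge_min lexx invr_gt0 ltr0n divr_gt0 ?mulr_gt0 //.
  by split=> //; rewrite -ler_pdivlMr ?mulr_gt0 // ge_min lexx orbT.
exists (Num.min (r / 4) (c / K)); first by rewrite lt_min !divr_gt0.
move=> x; rewrite lt_min !ltr_pdivlMr // => /andP[xr xc].
(* For [x] beyond the segment from [e] to [w]: either [t <= 1/2], so [s > 1/2], or [t *: w] has norm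
   at least [r / 2] while [x] has norm below [r / 4], so that [s *: e] must make up the
   difference. *)
have coef e w s t : norm1 e <= L -> r <= norm1 w -> 0 <= s -> 0 <= t ->
    1 < s + t -> x = s *: e + t *: w -> c <= s.
  move=> eL rw s0 t0 st xE.
  have [t2|t2] := leP t 2^-1; first lra.
  have : norm1 (t *: w) <= norm1 x + norm1 (s *: e).
    rewrite -[norm1 (s *: e)]norm1N; apply: le_trans _ (norm1D _ _).
    by rewrite xE addrC addKr.
  rewrite !norm1Z !ger0_norm // => h.
  have h1 : r / 2 <= t * norm1 w by nra.
  have h2 : s * norm1 e <= s * L by rewrite ler_wpM2l.
  have h3 : r / 4 <= s * L by lra.
  by rewrite -(ler_pM2r L0); lra.
split.
  move=> [s [t [s0 t0 xE]]]; exists s, t; split=> //.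
  have := hK s t; rewrite -xE !ger0_norm // ; lra.
move=> w rw [s1 [t1 [s10 t10 xE1]]] [s2 [t2 [s20 t20 xE2]]].
have [h1|h1] := leP (s1 + t1) 1; first by left; exists s1, t1.
have [h2|h2] := leP (s2 + t2) 1; first by right; exists s2, t2.
exfalso.
have s1c : c <= s1.
  by apply: coef xE1 => //; rewrite /L; have := norm1_ge0 b; lra.
have s2c : c <= s2.
  by apply: coef xE2 => //; rewrite /L; have := norm1_ge0 a; lra.
have [t12|t12] := eqVneq (t1 + t2) 0.
  have := hK s1 (- s2); suff -> : s1 *: a + - s2 *: b = 0.
    by rewrite /norm1 !mxE normr0 addr0 mulr0 normrN !ger0_norm //; lra.
  have t1E : t1 = 0 by lra.
  have t2E : t2 = 0 by lra.
  by rewrite scaleNr; apply/eqP; rewrite subr_eq0; apply/eqP; move: xE1 xE2;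
     rewrite t1E t2E !scale0r !addr0 => <-.
(* Eliminating [w] between the two expressions of [x] equates a combination of [a] and [b] with a
   multiple of [x]. Its coefficients total at least [c * (t1 + t2)], too much for so short a
   vector. *)
have := hK (t2 * s1) (- (t1 * s2)).
have -> : (t2 * s1) *: a + - (t1 * s2) *: b = (t2 - t1) *: x.
  by rewrite scalerBl {1}xE1 {1}xE2; apply: plane_eq; rewrite !mxE; ring.
rewrite norm1Z normrN (ger0_norm (mulr_ge0 t20 s10)) (ger0_norm (mulr_ge0 t10 s20)).
have : `|t2 - t1| <= t1 + t2 by rewrite ler_norml; lra.
have := normr_ge0 (t2 - t1); have := norm1_ge0 x.
move: `|_| (norm1 x) xc => D n nc n0 D0 hD hh.
have T0 : 0 < t1 + t2 by rewrite lt_def t12 addr_ge0.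
have h3 : c * (t1 + t2) <= t2 * s1 + t1 * s2 by nra.
have h4 : K * (D * n) <= (t1 + t2) * (n * K).
  by rewrite mulrCA [K * n]mulrC ler_wpM2r // mulr_ge0 // ltW.
have h5 : (t1 + t2) * (n * K) < (t1 + t2) * c by rewrite ltr_pM2l.
lra.
Qed.

End PlaneAlgebra.

(** * Sectors spanned by three directions *)

Section Sectors.
Context {R : realType}.
Implicit Types (a b h u y : plane R).

(* [phi 0], [phi 1], [phi 2] sum to zero, and [phi j] is positive on two of the
   vectors (1, 0), (0, 1), (-1, -1) and negative on the [j]-th one. *)
Definition phi (j : nat) u : R :=
  [:: u 0 1 - 2 * u 0 0; u 0 0 - 2 * u 0 1; u 0 0 + u 0 1]`_j.

(** An open condition, which leaves room for perturbation. Any two of the vectors share a positive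
    [phi j], hence so does the sector between them, wherever exactly they lie. *)
Definition spread y0 y1 y2 :=
  [/\ 0 < phi 1 y0 /\ 0 < phi 2 y0, 0 < phi 2 y1 /\ 0 < phi 0 y1 &
      0 < phi 0 y2 /\ 0 < phi 1 y2].

Definition counterclockwise y0 y1 y2 :=
  [/\ 0 < cross y0 y1, 0 < cross y1 y2 & 0 < cross y2 y0].

Lemma counterclockwise_rot y0 y1 y2 :
  counterclockwise y0 y1 y2 -> counterclockwise y1 y2 y0.
Proof. by case. Qed.

(** [cross] is a third of the determinant in the coordinates [phi 1], [phi 2] (and cyclically). As
    the three [phi] sum to zero, it expands into products of positive values. *)
Lemma spread_counterclockwise y0 y1 y2 :
  spread y0 y1 y2 -> counterclockwise y0 y1 y2.
Proof.
have pos (p q r s : R) : 0 < p -> 0 < q -> 0 < r -> 0 < s ->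
    0 < (p * s + q * r + q * s) / 3 by move=> *; rewrite divr_gt0 ?addr_gt0 ?mulr_gt0.
case=> -[h01 h02] [h12 h10] [h20 h21]; split.
- have := pos _ _ _ _ h01 h02 h10 h12; congr (0 < _).
  by rewrite /phi /cross /=; field.
- have := pos _ _ _ _ h12 h10 h21 h20; congr (0 < _).
  by rewrite /phi /cross /=; field.
- have := pos _ _ _ _ h20 h21 h02 h01; congr (0 < _).
  by rewrite /phi /cross /=; field.
Qed.

Lemma phi_lin j (s t : R) a b : phi j (s *: a + t *: b) = s * phi j a + t * phi j b.
Proof.
rewrite /phi !mxE; case: j => [|[|[|j]]] /=; last by rewrite !nth_nil !mulr0 addr0.
all: by ring.
Qed.

Lemma phi_sub j a b : phi j (a - b) = - phi j (b - a).
Proof.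
rewrite /phi !mxE; case: j => [|[|[|j]]] /=; last by rewrite !nth_nil oppr0.
all: by ring.
Qed.

Lemma phi_cone_gt0 j a b u : 0 < phi j a -> 0 < phi j b -> in_cone a b u ->
  u != 0 -> 0 < phi j u.
Proof.
move=> ha hb [s [t [s0 t0 ->]]]; rewrite phi_lin.
have [->|s1] := eqVneq s 0; have [->|t1] := eqVneq t 0.
- by rewrite !scale0r addr0 eqxx.
- by move=> _; rewrite mul0r add0r mulr_gt0 // lt_def t1.
- by move=> _; rewrite mul0r addr0 mulr_gt0 // lt_def s1.
- by move=> _; rewrite addr_gt0 // mulr_gt0 // lt_def ?s1 ?t1.
Qed.

Lemma in_cone_cross a b u : 0 < cross a b -> 0 <= cross a u -> 0 <= cross u b ->
  in_cone a b u.
Proof.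
move=> ab au ub; exists (cross u b / cross a b), (cross a u / cross a b).
split; [exact: divr_ge0 ub (ltW ab) | exact: divr_ge0 au (ltW ab) |].
by apply: cross_decompose; rewrite gt_eqF.
Qed.

(** The relation [E] has positive weights, so the values [cross y0 u], [cross y1 u], [cross y2 u]
    are neither all positive nor all negative; [u] lies in the sector where, in cyclic order, they
    drop from nonnegative to nonpositive. *)
Lemma cone_cover y0 y1 y2 u : counterclockwise y0 y1 y2 ->
  [\/ in_cone y0 y1 u, in_cone y1 y2 u | in_cone y2 y0 u].
Proof.
case=> h01 h12 h20.
have E : cross y1 y2 * cross y0 u + cross y2 y0 * cross y1 u
         + cross y0 y1 * cross y2 u = 0 by rewrite /cross; ring.
have N y : cross u y = - cross y u by exact: cross_antisym.
have [p0|p0] := leP 0 (cross y0 u); have [p1|p1] := leP 0 (cross y1 u);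
  have [p2|p2] := leP 0 (cross y2 u).
- have [z1|z1] := leP (cross y1 u) 0.
    by apply: Or31; apply: in_cone_cross; rewrite ?N //; lra.
  have [z2|z2] := leP (cross y2 u) 0.
    by apply: Or32; apply: in_cone_cross; rewrite ?N //; lra.
  by exfalso; nra.
- by apply: Or32; apply: in_cone_cross; rewrite ?N //; lra.
- by apply: Or31; apply: in_cone_cross; rewrite ?N //; lra.
- by apply: Or31; apply: in_cone_cross; rewrite ?N //; lra.
- by apply: Or33; apply: in_cone_cross; rewrite ?N //; lra.
- by apply: Or32; apply: in_cone_cross; rewrite ?N //; lra.
- by apply: Or33; apply: in_cone_cross; rewrite ?N //; lra.
- by exfalso; nra.
Qed.

(** The turn from [a] to [b] by less than a half-turn either passes [y1] or goes the other way round
    and passes [y0]. *)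
Lemma consecutive_cones_hit y0 y1 y2 a b : counterclockwise y0 y1 y2 ->
  in_cone y0 y1 a -> in_cone y1 y2 b -> cross a b != 0 ->
  exists2 y, y \in [:: y0; y1; y2] & in_cone a b y.
Proof.
case=> h01 h12 h20 [s [t [s0 t0 aE]]] [p [q [p0 q0 bE]]].
rewrite neq_lt => /orP[ab|ab]; last first.
  exists y1; first by rewrite !inE eqxx orbT.
  apply: in_cone_cross => //.
    have -> : cross a y1 = s * cross y0 y1 by rewrite aE /cross !mxE; ring.
    by rewrite mulr_ge0 // ltW.
  have -> : cross y1 b = q * cross y1 y2 by rewrite bE /cross !mxE; ring.
  by rewrite mulr_ge0 // ltW.
exists y0; first by rewrite !inE eqxx.
have abE : cross a b =
    s * (p * cross y0 y1 - q * cross y2 y0) + t * (q * cross y1 y2).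
  by rewrite aE bE /cross !mxE; ring.
apply/in_coneC/in_cone_cross.
- by rewrite cross_antisym oppr_gt0.
- have -> : cross b y0 = q * cross y2 y0 - p * cross y0 y1.
    by rewrite bE /cross !mxE; ring.
  rewrite leNgt; apply/negP => h; move: ab; rewrite abE ltNge => /negP; apply.
  by rewrite addr_ge0 // mulr_ge0 // ?mulr_ge0 // ?ltW //; lra.
- have -> : cross y0 a = t * cross y0 y1 by rewrite aE /cross !mxE; ring.
  by rewrite mulr_ge0 // ltW.
Qed.

Lemma same_cone_or_hit (K : set (plane R)) y0 y1 y2 a :
  counterclockwise y0 y1 y2 ->
  (forall a b, K a -> K b -> a <> b -> cross a b != 0) ->
  K a -> in_cone y0 y1 a ->
  (exists a b y, [/\ K a, K b, a <> b, y \in [:: y0; y1; y2] & in_cone a b y]) \/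
  (forall b, K b -> in_cone y0 y1 b).
Proof.
move=> ccw ncK Ka ya.
have [hit|nohit] := pselect (exists a b y,
  [/\ K a, K b, a <> b, y \in [:: y0; y1; y2] & in_cone a b y]); [by left|right].
move=> b Kb; have [ab|ab] := pselect (a = b); first by rewrite -ab.
have := cone_cover b ccw; case=> // yb; exfalso; apply: nohit.
  have [y yin yab] := consecutive_cones_hit ccw ya yb (ncK _ _ Ka Kb ab).
  by exists a, b, y; split.
have ba : b <> a by move=> ba; apply: ab.
have ccw' : counterclockwise y2 y0 y1 by do 2! apply: counterclockwise_rot.
have [y yin yba] := consecutive_cones_hit ccw' yb ya (ncK _ _ Kb Ka ba).
exists b, a, y; split=> //.
by move: yin; rewrite !inE => /or3P[] ->; rewrite ?orbT.
Qed.

(** [K] will consist of the vectors from one vertex of the polygon to the others. A sector gets the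
    index [j] whose [phi j] is positive on both its generators. *)
Lemma sector_or_hit (K : set (plane R)) y0 y1 y2 :
  spread y0 y1 y2 -> (forall a, K a -> a != 0) ->
  (forall a b, K a -> K b -> a <> b -> cross a b != 0) ->
  (exists a b y, [/\ K a, K b, a <> b, y \in [:: y0; y1; y2] & in_cone a b y]) \/
  (exists j : 'I_3, forall a, K a -> 0 < phi j a).
Proof.
move=> spr K0 ncK; have ccw := spread_counterclockwise spr.
have ccw' := counterclockwise_rot ccw; have ccw'' := counterclockwise_rot ccw'.
have [[a Ka]|noa] := pselect (exists a, K a); last first.
  by right; exists ord0 => a Ka; exfalso; apply: noa; exists a.
case: spr => -[s01 s02] [s12 s10] [s20 s21].
have perm3 a' b' y z0 z1 z2 :
    [/\ K a', K b', a' <> b', y \in [:: z0; z1; z2] & in_cone a' b' y] ->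
    perm_eq [:: z0; z1; z2] [:: y0; y1; y2] ->
    exists a b y, [/\ K a, K b, a <> b, y \in [:: y0; y1; y2] & in_cone a b y].
  by case=> Ka' Kb' ab yin yab /perm_mem pm; exists a', b', y; rewrite -pm.
have := cone_cover a ccw; case=> ya.
- have [|all1] := same_cone_or_hit ccw ncK Ka ya; first by left.
  right; exists (Ordinal (isT : 2 < 3)%N) => b Kb.
  by apply: (phi_cone_gt0 _ _ (all1 b Kb)) => //; apply: K0.
- have [[a' [b' [y h]]]|all1] := same_cone_or_hit ccw' ncK Ka ya.
    by left; apply: perm3 h _; rewrite (perm_catC [:: y1; y2] [:: y0]).
  right; exists (Ordinal (isT : 0 < 3)%N) => b Kb.
  by apply: (phi_cone_gt0 _ _ (all1 b Kb)) => //; apply: K0.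
- have [[a' [b' [y h]]]|all1] := same_cone_or_hit ccw'' ncK Ka ya.
    by left; apply: perm3 h _; rewrite (perm_catC [:: y2] [:: y0; y1]).
  right; exists (Ordinal (isT : 1 < 3)%N) => b Kb.
  by apply: (phi_cone_gt0 _ _ (all1 b Kb)) => //; apply: K0.
Qed.

End Sectors.

(** * Convex hulls, general position and guarded points *)

Section Hulls.
Context {R : realType}.
Implicit Types (A C H V : set (plane R)) (a b e p q u v w x y z : plane R).
Implicit Types (E : seq (plane R)).

Lemma convex_setP C : @convex_set R (plane R) C <->
  forall x y (s : R), 0 <= s -> s <= 1 -> C x -> C y -> C (s *: x + (1 - s) *: y).
Proof.
split=> cC x y => [s s0 s1 Cx Cy|l /set_mem Cx /set_mem Cy].
  by have := cC x y (Itv01 s0 s1) (mem_set Cx) (mem_set Cy); rewrite in_setE.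
by rewrite in_setE; apply: cC.
Qed.

Lemma sub_hull A : A `<=` convex_hull A.
Proof. exact: sub_gen_smallest. Qed.

Lemma hull_min A C : @convex_set R (plane R) C -> A `<=` C -> convex_hull A `<=` C.
Proof. by move=> cC AC; apply: smallest_sub. Qed.

Lemma hull_convex A : @convex_set R (plane R) (convex_hull A).
Proof.
apply/convex_setP => x y s s0 s1 Ax Ay C [cC AC].
by move/convex_setP: (cC); apply=> //; [apply: Ax|apply: Ay].
Qed.

Lemma hull_sub A C : A `<=` C -> convex_hull A `<=` convex_hull C.
Proof. by move=> AC; apply: hull_min (@hull_convex C) _ => x /AC; apply: sub_hull. Qed.

Lemma hull_triangle A v a b x : A v -> A a -> A b ->
  in_triangle (a - v) (b - v) (x - v) -> convex_hull A x.
Proof.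
move=> Av Aa Ab [s [t [s0 t0 st xE]]].
have /convex_setP cA := @hull_convex A.
have xE' : x = v + (s *: (a - v) + t *: (b - v)) by rewrite -xE addrC subrK.
have [st0|st0] := eqVneq (s + t) 0.
  have s1 : s = 0 by lra.
  have t1 : t = 0 by lra.
  by rewrite xE' s1 t1 !scale0r !addr0; apply: sub_hull.
(* Convexity is binary: [x] mixes [v] with a point of the segment from [a] to [b]. *)
have -> : x = (1 - (s + t)) *: v
    + (1 - (1 - (s + t))) *: ((s / (s + t)) *: a + (1 - s / (s + t)) *: b).
  by rewrite xE'; apply: plane_eq; rewrite !mxE; field.
apply: (cA); [lra|lra|exact: sub_hull|].
apply: cA; [|rewrite ler_pdivrMr; [lra|]|exact: sub_hull|exact: sub_hull].
  by apply: divr_ge0; lra.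
by rewrite lt_def st0 addr_ge0.
Qed.

(* [convex_hull V] is the point [v] together with the points [v + t (w - v)],
   [0 < t <= 1], [w] in the hull of [V `\ v]; the latter form a convex set
   missing [v]. *)
Lemma hull_vertex V H v : V v -> ~ convex_hull (V `\ v) v ->
  convex_hull H = convex_hull V -> H v.
Proof.
move=> Vv vV HV; apply: contrapT => Hv.
set W := convex_hull (V `\ v) in vV.
pose C := [set p | exists (t : R) w, [/\ 0 < t, t <= 1, W w & p = v + t *: (w - v)]].
have /convex_setP cW : @convex_set R (plane R) W by exact: hull_convex.
have cC : @convex_set R (plane R) C.
  apply/convex_setP => x y s s0 s1 [t [w [t0 t1 Ww xE]]] [t' [w' [t'0 t'1 Ww' yE]]].
  have T0 : 0 < s * t + (1 - s) * t'.
    have [->|s'] := eqVneq s 0; first by rewrite mul0r subr0 mul1r add0r.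
    have s'0 : 0 < s by rewrite lt_def s'.
    by apply: ltr_wpDr; [apply: mulr_ge0; lra | apply: mulr_gt0].
  exists (s * t + (1 - s) * t'), ((s * t / (s * t + (1 - s) * t')) *: w
    + (1 - s * t / (s * t + (1 - s) * t')) *: w'); split=> //.
  - by nra.
  - apply: cW => //; first by apply: divr_ge0 (ltW T0); apply: mulr_ge0 (ltW t0).
    by rewrite ler_pdivrMr // mul1r lerDl; apply: mulr_ge0; lra.
  - have T1 := lt0r_neq0 T0.
    by rewrite xE yE; apply: plane_eq; rewrite !mxE; field.
have nCv : ~ C v.
  case=> t [w [t0 t1 Ww /eqP]]; rewrite -subr_eq0 opprD addrA subrr add0r oppr_eq0.
  by rewrite scaler_eq0 gt_eqF //= subr_eq0 => /eqP wv; apply: vV; rewrite -wv.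
have VCv : convex_hull V `<=` C `|` [set v].
  apply: hull_min => [|w Vw]; last first.
    have [->|wv] := pselect (w = v); [by right|left].
    exists 1, w; split=> //; last by rewrite scale1r addrC subrK.
    by apply: sub_hull; split.
  have Cv y (s : R) : 0 <= s -> s <= 1 -> C y ->
      (C `|` [set v]) (s *: v + (1 - s) *: y).
    move=> s0 s1 [t [w [t0 t1 Ww yE]]].
    have [->|sn1] := eqVneq s 1; first by right; rewrite scale1r subrr scale0r addr0.
    left; exists ((1 - s) * t), w; split=> //.
    + by rewrite mulr_gt0 // subr_gt0 lt_neqAle sn1.
    + by nra.
    + by rewrite yE; apply: plane_eq; rewrite !mxE; ring.
  apply/convex_setP => x y s s0 s1 [Cx|->] [Cy|->].
  - by left; move/convex_setP: cC; apply.
  - have -> : s *: x + (1 - s) *: v = (1 - s) *: v + (1 - (1 - s)) *: x.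
      by rewrite addrC subKr.
    by apply: Cv => //; lra.
  - exact: Cv.
  - by right; rewrite -scalerDl addrC subrK scale1r.
have HC : H `<=` C.
  move=> h Hh; have : (C `|` [set v]) h by apply: VCv; rewrite -HV; apply: sub_hull.
  by case=> // hv; case: Hv; rewrite -hv.
by apply: nCv; apply: (hull_min cC HC); rewrite HV; apply: sub_hull.
Qed.

Lemma collinear_cross x y z : x <> y ->
  (collinear x y z <-> cross (y - x) (z - x) = 0).
Proof.
move=> xy; split.
  case=> L [p [d [d0 ->]]] sub.
  have [t1 _ <-] := sub x (or_introl (or_introl erefl)).
  have [t2 _ <-] := sub y (or_introl (or_intror erefl)).
  have [t3 _ <-] := sub z (or_intror erefl).
  by rewrite /cross !mxE; ring.
have yx0 : y - x != 0 by rewrite subr_eq0; apply/eqP => yx; apply: xy.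
move=> /(cross0_parallel yx0)[t zE].
exists [set x + t *: (y - x) | t in [set: R]]; first by exists x, (y - x).
move=> u [[->|->]|->].
- by exists 0; rewrite // scale0r addr0.
- by exists 1; rewrite // scale1r addrC subrK.
- by exists t; rewrite // -zE addrC subrK.
Qed.

Lemma general_position_cross A : general_position A <->
  forall x y z, A x -> A y -> A z -> x <> y -> y <> z -> x <> z ->
    cross (y - x) (z - x) != 0.
Proof.
split=> gp x y z Ax Ay Az xy yz xz.
  by apply/eqP => h; apply: (gp x y z) => //; apply/(collinear_cross _ xy).
by move/(collinear_cross _ xy)/eqP; apply/negP/gp.
Qed.

(** The conclusion of [guard_exists] with origin moved to [v]; [E] will hold the Maker points older
    than [v], and [r] the radius of its disc. *)
Definition guarded v E (r : R) x := forall e1 e2, e1 \in E -> e2 \in E -> e1 <> e2 ->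
  (in_cone (e1 - v) (e2 - v) (x - v) -> in_triangle (e1 - v) (e2 - v) (x - v)) /\
  (forall w, r <= norm1 (w - v) ->
     in_cone (e1 - v) (w - v) (x - v) -> in_cone (e2 - v) (w - v) (x - v) ->
     in_triangle (e1 - v) (w - v) (x - v) \/ in_triangle (e2 - v) (w - v) (x - v)).

(** Exchanging a generator of the cone over [a], [b] for [e1], then one for [e2], puts [x] in the
    cone over [e1], [e2], or in those over [e1], [w] and over [e2], [w]; [guarded] turns either case
    into a triangle. *)
Lemma hull_pierced A v E r x e1 e2 a b :
  guarded v E r x -> e1 \in E -> e2 \in E -> e1 <> e2 ->
  (forall p q, p = x \/ A p -> A q -> p <> v -> q <> v -> p <> q ->
     cross (p - v) (q - v) != 0) ->
  x <> v -> ~ A x -> A v -> (A `\ v) e1 -> (A `\ v) e2 -> (A `\ v) a -> (A `\ v) b ->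
  a <> b -> in_cone (a - v) (b - v) (x - v) ->
  ~ convex_hull (A `\ v) v ->
  (forall w, (A `\ v) w -> r <= norm1 (w - v)) ->
  convex_hull A x.
Proof.
move=> gx e1E e2E e12 nc xv nAx Av Ae1 Ae2 Aa Ab ab xab nv far.
(* Divided by [1 + s + t], such a relation would make [v] a convex combination of other points of
   [A]. *)
have noopp e p q : (A `\ v) e -> (A `\ v) p -> (A `\ v) q ->
    ~ exists s t : R, [/\ 0 <= s, 0 <= t & (e - v) + s *: (p - v) + t *: (q - v) = 0].
  move=> Ae Ap Aq [s [t [s0 t0 E0]]]; apply: nv; apply: (hull_triangle Ae Ap Aq).
  have T0 : 0 < 1 + s + t by lra.
  exists (s / (1 + s + t)), (t / (1 + s + t)); split.
  - by rewrite divr_ge0 // ltW.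
  - by rewrite divr_ge0 // ltW.
  - by rewrite -mulrDl ler_pdivrMr //; lra.
  - apply: (scalerI (lt0r_neq0 T0)); apply/eqP; rewrite eq_sym -subr_eq0 -E0.
    by apply/eqP/plane_eq; rewrite !mxE; field; rewrite lt0r_neq0.
have nocone e : (A `\ v) e -> ~ in_cone (e - v) (e - v) (x - v).
  move=> [Ae ev] [s [t [_ _ xE]]].
  have xe : x <> e by move=> xe; apply: nAx; rewrite xe.
  have := nc x e (or_introl erefl) Ae xv ev xe; rewrite xE -scalerDl.
  by rewrite /cross !mxE mulrAC subrr eqxx.
have ncA p q : (A `\ v) p -> (A `\ v) q -> p <> q -> cross (p - v) (q - v) != 0.
  by case=> Ap pv [Aq qv] pq; apply: nc => //; right.
have [w Aw xw] : exists2 w, (A `\ v) w & in_cone (e1 - v) (w - v) (x - v).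
  have := in_cone_exchange (e1 - v) (ncA _ _ Aa Ab ab) xab.
  case=> [h|h|/noopp]; [by exists a => //; apply: in_coneC|by exists b|].
  by case.
have we1 : e1 <> w by move=> we1; apply: (nocone e1); rewrite // {2}we1.
have gA := gx _ _ e1E e2E e12.
have [e2w|e2w] := pselect (e2 = w).
  case: gA => gA _; apply: (hull_triangle Av Ae1.1 Ae2.1); apply: gA.
  by rewrite e2w.
have := in_cone_exchange (e2 - v) (ncA _ _ Ae1 Aw we1) xw.
case=> [h|h|/noopp]; last by case.
  by case: gA => gA _; apply: (hull_triangle Av Ae1.1 Ae2.1); apply: gA.
case: gA => _ /(_ w (far _ Aw) xw h)[h1|h1].
  exact: (hull_triangle Av Ae1.1 Aw.1).
exact: (hull_triangle Av Ae2.1 Aw.1).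
Qed.

End Hulls.

(** * Placing shields in general position *)

Section Shields.
Context {R : realType}.
Implicit Types (a b c d e p u v w x y : plane R) (E h : seq (plane R)).

Definition point (s t : R) : plane R := \row_j [:: s; t]`_j.

Lemma point0 s t : point s t 0 0 = s. Proof. by rewrite mxE. Qed.
Lemma point1 s t : point s t 0 1 = t. Proof. by rewrite mxE. Qed.

(** A whole disc is produced, not just a point, so that [avoid_lines] can treat the next line inside
    it. *)
Lemma avoid_line c p d (r : R) : 0 < r -> d != 0 -> exists c' r', 0 < r' /\
  forall x, norm1 (x - c') < r' -> norm1 (x - c) < r /\ cross d (x - p) != 0.
Proof.
move=> r0 d0; have N0 := norm1_gt0 d0.
have [c0 c0c c0p] : exists2 c0, norm1 (c0 - c) < r / 2 & cross d (c0 - p) != 0.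
  have [cp|cp] := eqVneq (cross d (c - p)) 0; last first.
    exists c => //; rewrite subrr -[0](scale0r 0) norm1Z normr0 mul0r; lra.
  (* [n] is [d] turned by a right angle: a shift along it leaves the line, and [norm1] is
     unchanged. *)
  pose n := point (- d 0 1) (d 0 0).
  have Nn : norm1 n = norm1 d by rewrite /norm1 point0 point1 normrN addrC.
  have k0 : 0 < r / (4 * norm1 d) by rewrite divr_gt0 ?mulr_gt0.
  exists (c + (r / (4 * norm1 d)) *: n).
    rewrite addrC addKr norm1Z Nn gtr0_norm // invfM mulrA mulfVK ?gt_eqF //; lra.
  have -> : cross d (c + (r / (4 * norm1 d)) *: n - p) =
      cross d (c - p) + r / (4 * norm1 d) * (d 0 0 ^+ 2 + d 0 1 ^+ 2).
    by rewrite /cross !mxE /=; ring.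
  rewrite cp add0r mulf_neq0 ?gt_eqF // lt_def addr_ge0 ?sqr_ge0 // andbT.
  apply: contraNneq d0 => /eqP.
  rewrite paddr_eq0 ?sqr_ge0 // !sqrf_eq0 => /andP[/eqP h0 /eqP h1].
  by apply/eqP/plane_eq; rewrite ?h0 ?h1 mxE.
exists c0, (Num.min (r / 2) (`|cross d (c0 - p)| / norm1 d)); split.
  by rewrite lt_min !divr_gt0 // normr_gt0.
move=> x; rewrite lt_min !ltr_pdivlMr // => /andP[xr xd]; split.
  by have := norm1D (x - c0) (c0 - c); rewrite addrA subrK; lra.
have -> : cross d (x - p) = cross d (x - c0) + cross d (c0 - p).
  by rewrite /cross !mxE; ring.
rewrite addr_eq0; apply/eqP => E1; have := cross_le d (x - c0).
by rewrite E1 normrN mulrC; lra.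
Qed.

(** A pair [l] encodes the line through [l.1] along [l.2]. Skipping null directions allows listing
    all pairs of points, equal ones included. *)
Lemma avoid_lines (L : seq (plane R * plane R)) c (r : R) : 0 < r ->
  exists c' r', 0 < r' /\ forall x, norm1 (x - c') < r' -> norm1 (x - c) < r /\
    forall l, l \in L -> l.2 != 0 -> cross l.2 (x - l.1) != 0.
Proof.
elim: L c r => [|l L IH] c r r0; first by exists c, r.
have [c1 [r1 [r10 h1]]] := IH c r r0.
have [l0|l0] := eqVneq l.2 0.
  exists c1, r1; split=> // x /h1[xc hx]; split=> // l'; rewrite inE.
  by case/orP => [/eqP-> |]; [rewrite l0 eqxx|exact: hx].
have [c2 [r2 [r20 h2]]] := avoid_line c1 l.1 r10 l0.
exists c2, r2; split=> // x /h2[/h1[xc hx] xl]; split=> // l'; rewrite inE.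
by case/orP => [/eqP-> //|]; exact: hx.
Qed.

Lemma legal_cross h x y z : legal h -> x \in h -> y \in h -> z \in h ->
  x <> y -> y <> z -> x <> z -> cross (y - x) (z - x) != 0.
Proof. by move=> [_ /general_position_cross gp]; apply: gp. Qed.

Lemma legal_catl h h' : legal (h ++ h') -> legal h.
Proof.
move=> [+ gp]; rewrite cat_uniq => /and3P[uh _ _]; split=> //.
by move=> x y z hx hy hz; apply: gp; rewrite /placed /= mem_cat ?hx ?hy ?hz.
Qed.

Lemma legal_rcons_near h c (r : R) : legal h -> 0 < r ->
  exists x, norm1 (x - c) < r /\ legal (rcons h x).
Proof.
move=> lh r0.
(* Avoiding the horizontal lines through the points of [h] makes [x] a new point even when [h] spans
   no line. *)
pose L := [seq (p, q - p) | p <- h, q <- h] ++ [seq (p, point 1 0) | p <- h].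
have [x [r' [r'0 /(_ x)]]] := avoid_lines L c r0.
rewrite subrr -{1}[0](scale0r 0) norm1Z normr0 mul0r => /(_ r'0)[xc off].
have offl p q : p \in h -> q \in h -> p <> q -> cross (q - p) (x - p) != 0.
  move=> ph qh pq; apply: (off (p, q - p)).
    by rewrite mem_cat allpairs_f.
  by rewrite subr_eq0; apply/eqP => qp; apply: pq.
have xh : x \notin h.
  apply/negP => xh.
  have : cross (point 1 0) (x - x) != 0.
    apply: (off (x, point 1 0)); first by rewrite mem_cat map_f ?orbT.
    by apply/eqP => /rowP/(_ 0) /eqP; rewrite !mxE oner_eq0.
  by rewrite subrr /cross !mxE !mulr0 subrr eqxx.
exists x; split=> //; split; first by rewrite rcons_uniq xh lh.1.
apply/general_position_cross => p q s.
rewrite /placed /= !mem_rcons !inE.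
case/predU1P => [->|ph]; case/predU1P => [->|qh]; case/predU1P => [->|sh] // pq qs ps.
- have -> : cross (q - x) (s - x) = cross (s - q) (x - q) by rewrite /cross !mxE; ring.
  exact: offl.
- have -> : cross (x - p) (s - p) = - cross (s - p) (x - p) by exact: cross_antisym.
  by rewrite oppr_eq0; apply: offl.
- exact: offl.
- exact: (legal_cross lh).
Qed.

Lemma legal_extend h n : legal h -> exists2 xs, size xs = n & legal (h ++ xs).
Proof.
move=> lh; elim: n => [|n [xs sxs lxs]]; first by exists [::]; rewrite ?cats0.
have [x [_ lx]] := legal_rcons_near 0 lxs ltr01.
by exists (rcons xs x); rewrite ?size_rcons ?sxs // -rcons_cat.
Qed.

Lemma common_radius (T : eqType) (s : seq T) (Q : T -> plane R -> Prop) v :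
  (forall t, t \in s -> exists2 d : R, 0 < d & forall x, norm1 (x - v) < d -> Q t x) ->
  exists2 d : R, 0 < d & forall x, norm1 (x - v) < d -> forall t, t \in s -> Q t x.
Proof.
elim: s => [|t s IH] hs; first by exists 1.
have [|d d0 hd] := IH; first by move=> t' t's; apply: hs; rewrite inE t's orbT.
have [d' d'0 hd'] := hs t (mem_head _ _).
exists (Num.min d d'); first by rewrite lt_min d0.
move=> x; rewrite lt_min => /andP[xd xd'] t'; rewrite inE => /predU1P[->|].
  exact: hd'.
exact: hd.
Qed.

Lemma guarded_near v E (r : R) : 0 < r ->
  (forall e1 e2, e1 \in E -> e2 \in E -> e1 <> e2 -> cross (e1 - v) (e2 - v) != 0) ->
  exists2 d : R, 0 < d & forall x, norm1 (x - v) < d -> guarded v E r x.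
Proof.
move=> r0 nc.
have [|d d0 hd] := @common_radius _ [seq (e1, e2) | e1 <- E, e2 <- E]
  (fun l x => l.1 <> l.2 ->
  (in_cone (l.1 - v) (l.2 - v) (x - v) -> in_triangle (l.1 - v) (l.2 - v) (x - v)) /\
  (forall w, r <= norm1 (w - v) ->
     in_cone (l.1 - v) (w - v) (x - v) -> in_cone (l.2 - v) (w - v) (x - v) ->
     in_triangle (l.1 - v) (w - v) (x - v) \/ in_triangle (l.2 - v) (w - v) (x - v))) v.
  move=> _ /allpairsP[[e1 e2] /= [e1E e2E ->]] /=.
  have [e12|e12] := eqVneq e1 e2; first by exists 1.
  have [d d0 hd] := guard_exists (nc _ _ e1E e2E (elimN eqP e12)) r0.
  exists d => // x xd _; have [h1 h2] := hd _ xd; split=> // w rw.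
  exact: h2.
exists d => // x xd e1 e2 e1E e2E e12.
by apply: (hd x xd (e1, e2)) => //; apply: allpairs_f.
Qed.

Definition shield v E (r : R) x0 x1 x2 :=
  spread (x0 - v) (x1 - v) (x2 - v) /\
  forall x, x \in [:: x0; x1; x2] -> guarded v E r x.

(** The tolerance [10^-1] is small enough to preserve the signs in [spread]; the distance is at most
    [2 * k + k / 10]. *)
Lemma legal_rcons_direction h v (k a b : R) : legal h -> 0 < k ->
  `|a| <= 1 -> `|b| <= 1 -> exists x, [/\ legal (rcons h x), norm1 (x - v) < 3 * k &
    [/\ k * (a - 10^-1) < (x - v) 0 0, (x - v) 0 0 < k * (a + 10^-1),
        k * (b - 10^-1) < (x - v) 0 1 & (x - v) 0 1 < k * (b + 10^-1)]].
Proof.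
move=> lh k0 a1 b1.
have k10 : 0 < k / 10 by rewrite divr_gt0.
have [x [xk lx]] := legal_rcons_near (v + k *: point a b) lh k10.
exists x; split=> //.
  have := norm1D (x - (v + k *: point a b)) (k *: point a b).
  rewrite opprD addrA subrK norm1Z gtr0_norm //.
  have : norm1 (point a b) <= 2 by rewrite /norm1 point0 point1; lra.
  move: xk; rewrite opprD addrA; set N := norm1 (point a b); nra.
have := norm1_lt xk; rewrite !mxE /= => -[h1 h2 h3 h4].
by split; lra.
Qed.

Lemma place_shield h v E (r : R) : legal h -> v \in h -> {subset E <= h} ->
  v \notin E -> 0 < r ->
  exists x0 x1 x2, legal (h ++ [:: x0; x1; x2]) /\ shield v E r x0 x1 x2.
Proof.
move=> lh vh Eh vE r0.
have [|d d0 hd] := guarded_near r0 (v := v) (E := E).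
  move=> e1 e2 e1E e2E e12.
  have neqv e : e \in E -> v <> e by move=> eE ve; rewrite ve eE in vE.
  by apply: (legal_cross lh) => //; [exact: Eh|exact: Eh|exact: neqv|exact: neqv].
have k0 : 0 < d / 3 by rewrite divr_gt0.
have kd x : norm1 (x - v) < 3 * (d / 3) -> guarded v E r x.
  by rewrite mulrC mulfVK //; apply: hd.
have n0 : `|0 : R| <= 1 by rewrite normr0.
have n1 : `|1 : R| <= 1 by rewrite normr1.
have nN1 : `|- 1 : R| <= 1 by rewrite normrN normr1.
(* The targets are the directions (1, 0), (0, 1), (-1, -1) to which [phi] is adapted. *)
have [x0 [l0 /kd g0 c0]] := legal_rcons_direction v lh k0 n1 n0.
have [x1 [l1 /kd g1 c1]] := legal_rcons_direction v l0 k0 n0 n1.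
have [x2 [l2 /kd g2 c2]] := legal_rcons_direction v l1 k0 nN1 nN1.
exists x0, x1, x2; split; first by move: l2; rewrite -!cats1 -!catA.
split; last by move=> x; rewrite !inE => /or3P[] /eqP ->.
move: c0 c1 c2 => [? ? ? ?] [? ? ? ?] [? ? ? ?].
by rewrite /spread /phi /=; do ![split]; lra.
Qed.

End Shields.

(** * Maintaining the shelter, and what it excludes *)

Section Strategy.
Context {R : realType}.
Implicit Types (p q v w x : plane R) (h m o hs : seq (plane R)).

(* [m] lists Maker's points in order of placement. *)
Definition sheltered m h := exists r : plane R -> R,
  [/\ forall v, v \in m -> 0 < r v,
      forall v w, v \in m -> w \in m -> v <> w -> r v + r w < norm1 (v - w) &
      forall v, v \in m -> exists x0 x1 x2,
        [/\ forall x, x \in [:: x0; x1; x2] -> x \in h /\ x \notin m &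
            shield v (take (index v m) m) (r v) x0 x1 x2]].

Lemma notin_take_index (T : eqType) (s : seq T) (x : T) :
  x \notin take (index x s) s.
Proof. by rewrite in_take_leq ?index_size // ltnn. Qed.

Lemma exists_lt_all (T : eqType) (s : seq T) (f : T -> R) :
  (forall t, t \in s -> 0 < f t) ->
  exists2 d, 0 < d & forall t, t \in s -> d < f t.
Proof.
elim: s => [|t s IH] hs; first by exists 1.
have [|d d0 hd] := IH; first by move=> t' t's; apply: hs; rewrite inE t's orbT.
have ft0 := hs t (mem_head _ _).
exists (Num.min d (f t / 2)); first by rewrite lt_min d0 divr_gt0.
move=> t'; rewrite inE gt_min => /predU1P[->|/hd->//].
by apply/orP; right; lra.
Qed.

Lemma sheltered_step m h p s : (6 <= s)%N -> sheltered m h -> {subset m <= h} ->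
  legal (rcons h p) -> exists xs, [/\ size xs = s, legal (rcons h p ++ xs) &
    sheltered (rcons m p) (rcons h p ++ xs)].
Proof.
move=> s6 [r [r0 rsep rsh]] mh lp.
have ph : p \notin h by move: lp.1; rewrite rcons_uniq => /andP[].
have pm : p \notin m by apply: contra ph; apply: mh.
set M := rcons m p.
have Mh : {subset M <= rcons h p}.
  by move=> v; rewrite !mem_rcons !inE => /predU1P[->|/mh->]; rewrite ?eqxx ?orbT.
(* [q] is the centre of the disc that [p] entered, or [p] itself if there is none. *)
have [q qM qfar] : exists2 q, q \in M & forall v, v \in m -> v <> q -> r v < norm1 (p - v).
  have [[q qm qp]|noq] := pselect (exists2 q, q \in m & norm1 (p - q) <= r q).
    exists q; first by rewrite mem_rcons inE qm orbT.
    move=> v vm vq; have := rsep _ _ vm qm vq.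
    have := norm1D (v - p) (p - q); rewrite addrA subrK [norm1 (v - p)]norm1B; lra.
  exists p; first by rewrite mem_rcons mem_head.
  by move=> v vm _; rewrite ltNge; apply/negP => h'; apply: noq; exists v.
(* A radius below [f v] keeps the disc of [p] disjoint from that of [v]; for [v = q] it also shrinks
   the disc of [q] within the old one. *)
pose f v := if v == q then Num.min (r q) (norm1 (p - q) / 2) else norm1 (p - v) - r v.
have [|k k0 kf] := @exists_lt_all _ m f.
  move=> v vm; rewrite /f; case: eqVneq => [<-|/eqP vq].
    rewrite lt_min r0 //= divr_gt0 // norm1_gt0 // subr_eq0.
    by apply: contraNneq pm => ->.
  by rewrite subr_gt0 qfar.
pose r' v := if v \in [:: p; q] then k else r v.
have kq : q \in m -> k < r q /\ k + k < norm1 (p - q).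
  by move=> qm; have := kf _ qm; rewrite /f eqxx lt_min => /andP[? ?]; split; lra.
have kother v : v \in m -> v <> q -> k + r v < norm1 (p - v).
  by move=> vm vq; have := kf _ vm; rewrite /f ifN; [lra|apply/eqP].
have [x0 [x1 [x2 [lx shx]]]] : exists x0 x1 x2,
    legal (rcons h p ++ [:: x0; x1; x2]) /\ shield p (take (index p M) M) k x0 x1 x2.
  apply: place_shield => //; first by rewrite mem_rcons mem_head.
    by move=> v /mem_take/Mh.
  exact: notin_take_index.
have [y0 [y1 [y2 [ly shy]]]] : exists y0 y1 y2,
    legal ((rcons h p ++ [:: x0; x1; x2]) ++ [:: y0; y1; y2]) /\
    shield q (take (index q M) M) k y0 y1 y2.
  apply: place_shield => //; first by rewrite mem_cat Mh.
    by move=> v /mem_take/Mh vM; rewrite mem_cat vM.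
  exact: notin_take_index.
(* Breaker's remaining points may go to any legal places. *)
have [zs szs lz] := legal_extend (s - 6) ly.
exists ([:: x0; x1; x2; y0; y1; y2] ++ zs).
have lz' : legal (rcons h p ++ ([:: x0; x1; x2; y0; y1; y2] ++ zs)).
  by move: lz; rewrite -!catA.
split=> //; first by rewrite size_cat szs /= subnKC.
have newM x : x \in [:: x0; x1; x2; y0; y1; y2] ++ zs -> x \notin M.
  move=> xin; apply/negP => /Mh xh; move: lz'.1.
  by rewrite cat_uniq => /and3P[_ /hasPn/(_ _ xin) /negP].
exists r'; split.
- move=> v; rewrite mem_rcons inE /r'; case: ifP => // nv /predU1P[vp|]; last exact: r0.
  by rewrite vp inE eqxx in nv.
- have sep v w : v \in [:: p; q] -> w \in m -> w \notin [:: p; q] ->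
      k + r w < norm1 (v - w).
    move=> vpq wm; rewrite !inE negb_or => /andP[_ /eqP wq].
    have [->|vp] := eqVneq v p; first exact: kother.
    have vq : v = q by move: vpq; rewrite !inE (negPf vp) => /eqP.
    have qm : q \in m by move: qM; rewrite mem_rcons inE -vq (negPf vp).
    have [kr _] := kq qm; have := rsep _ _ qm wm (fun E => wq (esym E)).
    by rewrite vq; lra.
  have sep2 : p <> q -> k + k < norm1 (p - q).
    move=> pq; apply: (kq _).2; move: qM; rewrite mem_rcons inE.
    by case/predU1P => // qp; case: pq.
  have inm v : v \in M -> v \notin [:: p; q] -> v \in m.
    by rewrite mem_rcons !inE negb_or => /predU1P[->|//]; rewrite eqxx.
  move=> v w vM wM vw; rewrite /r'; case: ifPn => vpq; case: ifPn => wpq.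
  + move: vpq wpq vw; rewrite !inE => /orP[] /eqP -> /orP[] /eqP -> vw.
    * by case: vw.
    * exact: sep2.
    * by rewrite norm1B; apply: sep2 => pq; apply: vw.
    * by case: vw.
  + exact: sep (inm _ wM wpq) wpq.
  + by rewrite addrC norm1B; apply: sep (inm _ vM vpq) vpq.
  + by apply: rsep => //; apply: inm.
- move=> v vM; rewrite /r'; case: ifPn => vpq.
    move: vpq; rewrite !inE => /orP[] /eqP ->.
      exists x0, x1, x2; split=> // x xin.
      have xin' : x \in [:: x0; x1; x2; y0; y1; y2] ++ zs.
        by rewrite (mem_cat x [:: x0; x1; x2] ([:: y0; y1; y2] ++ zs)) xin.
      by rewrite mem_cat xin' orbT newM.
    exists y0, y1, y2; split=> // x xin.
    have xin' : x \in [:: x0; x1; x2; y0; y1; y2] ++ zs.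
      by rewrite (mem_cat x [:: x0; x1; x2] ([:: y0; y1; y2] ++ zs)) mem_cat xin orbT.
    by rewrite mem_cat xin' orbT newM.
  have vm : v \in m.
    by move: vM vpq; rewrite mem_rcons !inE negb_or => /predU1P[->|//]; rewrite eqxx.
  (* The old shield of [v] remains valid: its radius and the list of points older than [v] are
     unchanged. *)
  have [z0 [z1 [z2 [zin shz]]]] := rsh v vm.
  exists z0, z1, z2; split; last first.
    by rewrite /M -cats1 index_cat vm takel_cat // index_size.
  move=> z /zin[zh zm]; split.
    by rewrite mem_cat mem_rcons inE zh orbT.
  rewrite mem_rcons inE negb_or zm andbT.
  by apply: contraNneq ph => <-.
Qed.

(** Used with [i] equal to 0 and 1: a subsequence keeps the order of placement, so its first two
    entries are older than every later one. *)
Lemma subseq_nth_take (T : eqType) (x : T) (s t : seq T) i j : uniq t -> subseq s t ->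
  (i < j)%N -> (j < size s)%N -> nth x s i \in take (index (nth x s j) t) t.
Proof.
move=> ut st ij js.
have pt : pairwise (fun y z => index y t < index z t)%N t.
  apply/(pairwiseP x) => a b; rewrite !inE => at_ bt ab.
  by rewrite !index_uniq.
have ps := subseq_pairwise st pt.
rewrite in_take_leq ?index_size //.
move/(pairwiseP x): ps => /(_ i j); apply=> //.
by rewrite inE (ltn_trans ij).
Qed.

Lemma sheltered_hull m h hs : sheltered m h -> legal h -> {subset m <= h} ->
  uniq m -> subseq hs m -> (6 <= size hs)%N ->
  (forall v, v \in hs -> ~ convex_hull ([set` hs] `\ v) v) ->
  exists x, [/\ x \in h, x \notin m & convex_hull [set` hs] x].
Proof.
move=> [r [r0 rsep rsh]] lh mh um sub shs vert; apply: contrapT => nox.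
have hm : {subset hs <= m} by exact: mem_subseq.
have hh w : w \in hs -> w \in h by move=> /hm/mh.
have uhs := subseq_uniq sub um.
(* The shift by 2 reserves entries 0 and 1 as the two older vertices needed by [hull_pierced]. *)
have small (i : 'I_4) : exists j : 'I_3, forall w, w \in hs -> w <> nth 0 hs i.+2 ->
    0 < phi j (w - nth 0 hs i.+2).
  have ihs : (i.+2 < size hs)%N by apply: leq_trans shs; exact: ltn_ord i.
  set v := nth 0 hs i.+2.
  have vhs : v \in hs by exact: mem_nth.
  have [x0 [x1 [x2 [xin [spr grd]]]]] := rsh v (hm _ vhs).
  have nc p q : p \in h -> q \in h -> p <> v -> q <> v ->
      p <> q -> cross (p - v) (q - v) != 0.
    move=> ph qh pv qv pq; apply: (legal_cross lh) => //; first exact: hh.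
      by move=> vp; apply: pv.
    by move=> vq; apply: qv.
  pose K := [set u | exists2 w, w \in hs /\ w <> v & u = w - v].
  have [||[_ [_ [y [[a [ah av] ->] [b [bh bv] ->] ab yin yab]]]]|[j hj]] :=
    sector_or_hit (K := K) spr.
  - move=> _ [w [_ wv] ->]; rewrite subr_eq0; exact/eqP.
  - move=> _ _ [a [ah av] ->] [b [bh bv] ->] ab.
    apply: nc => //; [exact: hh|exact: hh|by move=> E; apply: ab; rewrite E].
  - exfalso; apply: nox.
    have [x xin' yE] : exists2 x, x \in [:: x0; x1; x2] & y = x - v.
      by move: yin; rewrite !inE => /or3P[] /eqP ->; [exists x0|exists x1|exists x2];
        rewrite ?inE ?eqxx ?orbT.
    have [xh xm] := xin _ xin'.
    exists x; split=> //.
    have early k : (k < 2)%N -> nth 0 hs k \in take (index v m) m /\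
        ([set` hs] `\ v) (nth 0 hs k).
      move=> k2; have ki : (k < i.+2)%N by apply: leq_trans k2 _.
      have khs : (k < size hs)%N by apply: ltn_trans ihs.
      split; first exact: subseq_nth_take.
      split; first by rewrite /= mem_nth.
      by move/eqP; rewrite nth_uniq //; apply/negP; rewrite neq_ltn ki.
    have [e1E e1hs] := early 0%N isT; have [e2E e2hs] := early 1%N isT.
    apply: (hull_pierced (grd _ xin') e1E e2E (a := a) (b := b)) => //.
    + by apply/eqP; rewrite nth_uniq //; apply: leq_trans shs.
    + move=> p q [->|ph] qh pv qv pq; apply: nc => //; exact: hh.
    + by move=> xv; move: xm; rewrite xv hm.
    + by move=> /hm; apply/negP.
    + by move=> E; apply: ab; rewrite E.
    + by rewrite -yE.
    + exact: vert.
    (* Disjoint discs put [w] outside the disc of [v]. *)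
    + move=> w [wh wv]; have := rsep _ _ (hm _ wh) (hm _ vhs) wv.
      by have := r0 _ (hm _ wh); lra.
  - by exists j => w wh wv; apply: hj; exists w.
have [f hf] := fin_all_exists small.
(* Two vertices cannot share an index: [phi j] would be positive on their difference and on its
   opposite. *)
have : (#|'I_4| <= #|'I_3|)%N.
  apply: (leq_card f) => i i' fi; apply/eqP/negPn/negP => ii'.
  have ihs (k : 'I_4) : (k.+2 < size hs)%N by apply: leq_trans shs; exact: ltn_ord k.
  have neq : nth 0 hs i.+2 <> nth 0 hs i'.+2.
    by apply/eqP; rewrite nth_uniq // !eqSS.
  have h1 := hf i' _ (mem_nth 0 (ihs i)) neq.
  have h2 := hf i _ (mem_nth 0 (ihs i')) (fun E => neq (esym E)).
  by move: h1; rewrite phi_sub -fi; lra.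
by rewrite !card_ord.
Qed.

End Strategy.

(** * The strategy as a function of positions, and the course of play *)

Section Play.
Context {R : realType}.
Variable s : nat.
Implicit Types (p q v w x : plane R) (h m xs : seq (plane R)) (V : set (plane R)).

Lemma card_le_filter V (l : seq (plane R)) k : (V #= `I_k)%card ->
  V `<=` [set` l] -> (k <= size [seq v <- l | v \in V])%N.
Proof.
move=> /card_set_bijP [f [_ _ fsurj]] Vl.
rewrite -[X in (X <= _)%N](size_iota 0) -(size_map f); apply: uniq_leq_size.
  exact: iota_uniq.
move=> i; rewrite mem_iota add0n => /fsurj[v Vv <-].
by apply: map_f; rewrite mem_filter (mem_set Vv); apply: Vl.
Qed.

(* [o] holds the point that Maker placed after the position [h], if any. *)
Lemma sheltered_not_won k h h' m (o : seq (plane R)) : (7 <= k)%N ->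
  legal h -> {subset h <= h'} -> uniq m -> {subset m <= h} -> sheltered m h ->
  (size o <= 1)%N -> {in h, forall x, x \in o -> x \in m} ->
  maker_points s h' `<=` [set` m ++ o] -> ~ maker_won s k h'.
Proof.
move=> k7 lh hh' um mh shm o1 oh mko [H HM [_ cH [V [cV HV vertV]] HS]].
have VH : V `<=` H.
  by move=> v Vv; apply: hull_vertex Vv (vertV v Vv) HV.
pose hs := [seq v <- m | v \in V].
have hsV : [set` hs] `<=` V.
  by move=> v /=; rewrite mem_filter => /andP[/set_mem].
have hs6 : (6 <= size hs)%N.
  have Vmo : V `<=` [set` m ++ o] by move=> v /VH/HM/mko.
  have := card_le_filter cV Vmo; rewrite filter_cat size_cat.
  have : (size [seq v <- o | v \in V] <= size o)%N by rewrite size_filter count_size.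
  by rewrite -/hs; lia.
have [||x [xh xm xhull]] := sheltered_hull shm lh mh um _ hs6; first exact: filter_subseq.
  move=> v vhs; have Vv := hsV _ vhs; apply: contra_not (vertV v Vv).
  by apply: hull_sub => w [ws wv]; split=> //; apply: hsV.
(* Emptiness of the hole forces [x] into [H], hence among Maker's points; but [x] is in [h] and
   outside [m], which excludes both [m] and [o]. *)
have Hx : H x.
  rewrite -HS; split; last exact: hh'.
  by rewrite HV; apply: hull_sub hsV _ xhull.
have := mko _ (HM _ Hx); rewrite /= mem_cat (negPf xm) /= => /(oh _ xh).
by rewrite (negPf xm).
Qed.

Lemma maker_points_round h p xs : (s.+1 %| size h)%N -> (size xs <= s)%N ->
  maker_points s (rcons h p ++ xs) = maker_points s h `|` [set p].
Proof.
move=> hd xss; apply/seteqP; split => x.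
  case=> i /= /andP[]; rewrite size_cat size_rcons => ilt iturn <-.
  rewrite nth_cat size_rcons nth_rcons.
  case: (ltngtP i (size h)) => ih.
  - by rewrite ltnS (ltnW ih); left; exists i; rewrite //= ih.
  - exfalso; move: iturn; rewrite /maker_turn -(subnKC (ltnW ih)) dvdn_addr //.
    by by move/dvdn_leq; rewrite subn_gt0 => /(_ ih); lia.
  - by rewrite -ih ltnSn; right.
case=> [[i /= /andP[ih iturn] <-]|->].
  exists i; first by rewrite /= iturn size_cat size_rcons andbT; lia.
  by rewrite nth_cat size_rcons nth_rcons ih ltnS (ltnW ih).
exists (size h); first by rewrite /= /maker_turn hd size_cat size_rcons andbT; lia.
by rewrite nth_cat size_rcons nth_rcons ltnSn ltnn eqxx.
Qed.

Definition round_inv h := [/\ (s.+1 %| size h)%N, legal h & exists m,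
  [/\ uniq m, {subset m <= h}, maker_points s h = [set` m] & sheltered m h]].

Definition good_response h p xs :=
  [/\ size xs = s, legal (rcons h p ++ xs) & round_inv (rcons h p ++ xs)].

(** A choice of Breaker's whole reply to [p]; [response_good] shows that the default [[::]] does not
    arise in actual play. *)
Definition response h p : seq (plane R) := xget [::] [set xs | good_response h p xs].

(** A strategy sees only the position, so the reply is recomputed at each point: [n] is the length
    at the start of the round, entry [n] is Maker's point, and [size h - n.+1] counts Breaker's
    points since. *)
Definition shelter_strategy h : plane R :=
  let n := (size h %/ s.+1 * s.+1)%N in
  nth 0 (response (take n h) (nth 0 h n)) (size h - n.+1).

Lemma response_good h p : (6 <= s)%N -> round_inv h -> legal (rcons h p) ->
  good_response h p (response h p).
Proof.
move=> s6 [hd lh [m [um mh mkm shm]]] lp.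
have [xs [sxs lxs shxs]] := sheltered_step s6 shm mh lp.
apply: (@xgetPex _ [::] [set xs | good_response h p xs]); exists xs.
split=> //; split=> //; first by rewrite size_cat size_rcons sxs addSnnS dvdn_addl.
exists (rcons m p); split=> //.
- rewrite rcons_uniq um andbT; apply/negP => /mh.
  by move: lp.1; rewrite rcons_uniq => /andP[/negP].
- move=> v; rewrite mem_cat !mem_rcons !inE => /predU1P[->|/mh ->].
    by rewrite eqxx.
  by rewrite orbT.
- rewrite maker_points_round ?sxs // mkm; apply/seteqP; split=> v /=.
    by case=> [vm|->]; rewrite mem_rcons inE ?vm ?orbT ?eqxx.
  by rewrite mem_rcons inE => /predU1P[]; [right|left].
Qed.

(** [j] counts Breaker's points since [p]; at [j = s] the round is complete and [round_inv] takes
    over. *)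
Definition mid_round h h0 p j :=
  [/\ round_inv h0, legal (rcons h0 p), (j < s)%N & h = rcons h0 p ++ take j (response h0 p)].

Lemma mid_round_strategy h h0 p j : (6 <= s)%N -> mid_round h h0 p j ->
  rcons h (shelter_strategy h) = rcons h0 p ++ take j.+1 (response h0 p).
Proof.
move=> s6 [inv0 lp js ->]; have [sr _ _] := response_good s6 inv0 lp.
case: inv0 => hd _ _; rewrite (take_nth 0) ?sr // -rcons_cat; congr rcons.
rewrite /shelter_strategy.
have sz : size (rcons h0 p ++ take j (response h0 p)) = (size h0 + j.+1)%N.
  by rewrite size_cat size_rcons size_takel ?sr 1?ltnW // addSnnS.
have -> : (size (rcons h0 p ++ take j (response h0 p)) %/ s.+1 * s.+1)%N = size h0.
  by rewrite sz divnDl // mulnDl divnK // divn_small // mul0n addn0.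
rewrite sz -cats1 -catA take_size_cat // nth_cat ltnn subnn /=.
by congr nth; lia.
Qed.

Lemma follows_rcons (sigma : breaker_strategy) h x : follows s sigma (rcons h x) ->
  follows s sigma h /\ (~~ maker_turn s (size h) -> x = sigma h).
Proof.
move=> fol; split=> [i ih iturn|hturn].
  have := fol i; rewrite size_rcons ltnS (ltnW ih) nth_rcons ih => -> //.
  by rewrite -cats1 takel_cat // ltnW.
have := fol (size h); rewrite size_rcons ltnSn nth_rcons ltnn eqxx => -> //.
by rewrite -cats1 take_size_cat.
Qed.

Lemma round_inv_nil : round_inv [::].
Proof.
split=> //; exists [::]; split=> //; first by apply/seteqP; split=> // x [i].
by exists (fun=> 1).
Qed.

Lemma reachable h : (6 <= s)%N -> legal h -> follows s shelter_strategy h ->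
  round_inv h \/ exists h0 p j, mid_round h h0 p j.
Proof.
move=> s6; elim/last_ind: h => [|h x IH] lx; first by left; exact: round_inv_nil.
move=> /follows_rcons[fh xE].
have lh : legal h by move: lx; rewrite -cats1; apply: legal_catl.
have [inv0|[h0 [p [j hj]]]] := IH lh fh.
  right; exists h, x, 0%N; split=> //; first by apply: leq_trans s6.
  by rewrite take0 cats0.
have [inv0 lp js hE] := hj.
have [sr lr invr] := response_good s6 inv0 lp.
have hx : x = shelter_strategy h.
  apply: xE; rewrite hE size_cat size_rcons size_takel ?sr 1?ltnW // addSnnS.
  rewrite /maker_turn dvdn_addr; last by case: inv0.
  by apply/negP => /(dvdn_leq (ltn0Sn _)); lia.
have := mid_round_strategy s6 hj; rewrite -hx => ->.
have [js'|sj] := ltnP j.+1 s; first by right; exists h0, p, j.+1.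
by left; rewrite take_oversize // sr.
Qed.

Lemma shelter_strategy_winning k : (6 <= s)%N -> (7 <= k)%N ->
  winning s k shelter_strategy.
Proof.
move=> s6 k7 h lh fh.
have [inv0|[h0 [p [j hj]]]] := reachable s6 lh fh.
  have [hd _ [m [um mh mkm shm]]] := inv0; split; last by rewrite /maker_turn hd.
  by apply: (sheltered_not_won (m := m) (o := [::]) k7 lh) => //; rewrite cats0 mkm.
have [inv0 lp js hE] := hj; have [sr lr _] := response_good s6 inv0 lp.
split; last first.
  (* The completed round is legal, hence so is each prefix of it. *)
  move=> _; rewrite (mid_round_strategy s6 hj).
  apply: (@legal_catl _ _ (drop j.+1 (response h0 p))).
  by rewrite -catA cat_take_drop.
(* Within a round the shelter of [h0] still serves, [p] being the only Maker point outside it. *)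
have [hd lh0 [m [um mh mkm shm]]] := inv0.
apply: (sheltered_not_won (m := m) (o := [:: p]) k7 lh0) => //.
- by move=> v vh; rewrite hE mem_cat mem_rcons inE vh orbT.
- move=> v vh; rewrite inE => /eqP vp; move: lp.1.
  by rewrite rcons_uniq -vp vh.
- rewrite hE maker_points_round //; last by rewrite size_takel ?sr ltnW.
  rewrite mkm => v [vm|->] /=; first by rewrite mem_cat vm.
  by rewrite mem_cat mem_head orbT.
Qed.

End Play.

Lemma breaker_wins_6_7 (R : realType) (s k : nat) :
  (6 <= s)%N -> (7 <= k)%N -> breaker_wins R s k.
Proof. by move=> s6 k7; exists (@shelter_strategy R s); apply: shelter_strategy_winning. Qed.

Theorem theorem10 (R : realType) :
  (forall lambda k : nat, (3 <= lambda)%N ->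
     3 * Num.ceil ((2 * lambda%:R) / (lambda%:R - 2) : rat) - 1 <= k%:Z ->
     breaker_wins R (2 * lambda) k)
  /\ (forall k : nat, (17 <= k)%N -> breaker_wins R (2 * 3) k)
  /\ (forall lambda k : nat, lambda = 4%N \/ lambda = 5%N -> (11 <= k)%N ->
        breaker_wins R (2 * lambda) k)
  /\ (forall lambda k : nat, (6 <= lambda)%N -> (8 <= k)%N ->
        breaker_wins R (2 * lambda) k).
Proof.
split=> [lambda k l3 hk|].
  apply: breaker_wins_6_7; first by lia.
  have l3' : (3 : rat) <= lambda%:R by rewrite ler_nat.
  (* The quotient exceeds 2, so its ceiling is at least 3 and [k >= 8]. *)
  have : 2 < Num.ceil ((2 * lambda%:R) / (lambda%:R - 2) : rat).
    by rewrite ceil_gt_int ltr_pdivlMr; lra.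
  lia.
by do 2?[split] => *; apply: breaker_wins_6_7; lia.
Qed.
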